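(* Let $A_1=P_1J_1P_1^{-1}$ with $J_1=\begin{pmatrix}-n_1&1\\0&-n_1\end{pmatrix}$, $n_1>0$, and $A_2=P_2J_2P_2^{-1}$ with $J_2=\begin{pmatrix}\alpha_2&\beta_2\\-\beta_2&\alpha_2\end{pmatrix}$, $\alpha_2>0$, $\beta_2\ne0$; here $P_1,P_2$ are real invertible $2\times 2$ matrices chosen such that $M=P_2^{-1}P_1=\begin{pmatrix}a&b\\c&d\end{pmatrix}$ has determinant $1$ or $-1$. Given $\eta>0$, let $\tau_{2,1}(\eta)$ be the unique positive solution $t$ of $$\alpha_2\eta=n_1t-\sinh^{-1}\left(\left(\frac{a^2+c^2}{2}\right)t\right).$$ Then the switched system $\dot x(t)=A_{\sigma(t)}x(t)$ is stable for all $\sigma\in\mathcal S[\tau_{2,1}(\eta),\eta]$ and asymptotically stable for all $\sigma\in\mathcal S'[\tau_{2,1}(\eta),\eta]$.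
   Context: Planar switched system: $\dot x(t)=A_{\sigma(t)}x(t)$, $x(t)\in\mathbb R^2$ continuous in $t\ge0$, with $A_1,A_2$ real $2\times2$ matrices. A switching signal $\sigma:[0,\infty)\to\{1,2\}$ is right-continuous and piecewise constant with infinitely many discontinuities $0<d_1<d_2<\cdots$, $d_k\to\infty$; set $d_0=0$. For a signal with $\sigma(0)=1$ put $t_k=d_{2k-1}-d_{2k-2}$ (times spent in $A_1$) and $s_k=d_{2k}-d_{2k-1}$ (times spent in $A_2$), $k\ge1$. For $\tau,\eta>0$, $\mathcal S[\tau,\eta]$ is the set of signals with $\sigma(0)=1$, $t_k\ge\tau$ and $s_k\le\eta$ for all $k\in\mathbb N$; $\mathcal S'[\tau,\eta]$ is the set of $\sigma\in\mathcal S[\tau,\eta]$ for which the sequence $(t_k,s_k)_{k\ge1}$ does not converge to $(\tau,\eta)$. For a given signal $\sigma$, the system is stable if for every $\varepsilon'>0$ there is $\delta>0$ such that $\|x(0)\|<\delta$ implies $\|x(t)\|<\varepsilon'$ for all $t>0$; it is asymptotically stable if it is stable and $\|x(t)\|\to0$ as $t\to\infty$ for every $x(0)\in\mathbb R^2$. Norms are Euclidean. *)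

(* Defs.v *)
From mathcomp Require Import all_boot all_order all_algebra.
From mathcomp Require Import all_classical all_reals all_analysis.
From mathcomp Require Import ring lra.

Set Implicit Arguments.
Unset Strict Implicit.
Unset Printing Implicit Defensive.

Import Order.TTheory GRing.Theory Num.Theory.
Import numFieldNormedType.Exports.

Local Open Scope classical_set_scope.
Local Open Scope ring_scope.

Section Hyperbolic.
Context {R : realType}.
Implicit Types x : R.

Definition sinh x : R := (expR x - expR (- x)) / 2.

Definition asinh x : R := ln (x + Num.sqrt (x ^+ 2 + 1)).

Lemma asinhK : cancel asinh sinh.
Proof.
move=> x; rewrite /sinh /asinh expRN.
set r := Num.sqrt _.
have r2 : r ^+ 2 = x ^+ 2 + 1 by rewrite sqr_sqrtr// addr_ge0// sqr_ge0.
have r0 : 0 <= r by exact: sqrtr_ge0.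
have xr : 0 < x + r by nra.
rewrite lnK ?posrE//.
have -> : (x + r)^-1 = r - x.
  by apply: (mulfI (lt0r_neq0 xr)); rewrite divff ?lt0r_neq0//; nra.
by field.
Qed.

Lemma sinhK : cancel sinh asinh.
Proof.
move=> x; rewrite /asinh.
have e0 := expR_gt0 x; have f0 := expR_gt0 (- x).
have ef : expR x * expR (- x) = 1 by rewrite -expRD subrr expR0.
have -> : sinh x ^+ 2 + 1 = ((expR x + expR (- x)) / 2) ^+ 2.
  by rewrite -[X in _ + X = _]ef /sinh; field.
rewrite sqrtr_sqr ger0_norm; last by rewrite divr_ge0// addr_ge0// ltW.
have -> : sinh x + (expR x + expR (- x)) / 2 = expR x by rewrite /sinh; field.
exact: expRK.
Qed.

End Hyperbolic.

Section Matrices.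
Context {R : realType}.

Definition mx22 (a b c d : R) : 'M[R]_2 :=
  \matrix_(i, j) if i == 0 then (if j == 0 then a else b)
                 else (if j == 0 then c else d).

(* The library norm on matrices is the sup norm. *)
Definition enorm (n : nat) (x : 'cV[R]_n) : R :=
  Num.sqrt (\sum_(i < n) x i 0 ^+ 2).

End Matrices.

(* The index set {1, 2} of a signal is [bool], with its discrete topology:
   [true] is the index 1 and [false] is the index 2. Signals, and solutions
   below, are total functions on R of which only the restriction to [0, +oo[
   is ever constrained. *)
Section Signals.
Context {R : realType}.
Implicit Types (sigma : R -> bool) (d : R^nat) (tau eta : R).

Definition switching_times sigma d : Prop :=
  [/\ d 0%N = 0, (forall k, d k < d k.+1) & d k @[k --> \oo] --> +oo] /\
  [/\ forall t, 0 <= t -> sigma s @[s --> t^'+] --> sigma t,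
      forall k s t, d k < s < d k.+1 -> d k < t < d k.+1 -> sigma s = sigma t &
      forall k, ~ {for d k.+1, continuous sigma}].

(* With indices shifted to start at 0: for a signal starting in mode 1, the
   duration of the k-th stay in mode 1, resp. in mode 2. *)
Definition time1 d (k : nat) : R := d k.*2.+1 - d k.*2.
Definition time2 d (k : nat) : R := d k.*2.+2 - d k.*2.+1.

Definition signals tau eta : set (R -> bool) :=
  [set sigma | exists d, [/\ switching_times sigma d, sigma 0 = true &
    forall k, tau <= time1 d k /\ time2 d k <= eta]].

Definition signals' tau eta : set (R -> bool) :=
  [set sigma | signals tau eta sigma /\
    forall d, switching_times sigma d ->
      ~ ((time1 d k, time2 d k) @[k --> \oo] --> (tau, eta))].

End Signals.

Section SwitchedSystem.
Context {R : realType}.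

(* The equation is required off the switching instants, where x has in general
   only one-sided derivatives. *)
Definition solution (A1 A2 : 'M[R]_2) (sigma : R -> bool)
    (x : R -> 'cV[R]_2) : Prop :=
  {within `[0, +oo[, continuous x} /\
  forall t, 0 < t -> {for t, continuous sigma} ->
    is_derive t 1 x ((if sigma t then A1 else A2) *m x t).

Definition stable (A1 A2 : 'M[R]_2) (sigma : R -> bool) : Prop :=
  forall e : R, 0 < e -> exists2 delta : R, 0 < delta &
    forall x, solution A1 A2 sigma x -> enorm (x 0) < delta ->
      forall t, 0 < t -> enorm (x t) < e.

Definition asymptotically_stable (A1 A2 : 'M[R]_2) (sigma : R -> bool) : Prop :=
  stable A1 A2 sigma /\
  forall x, solution A1 A2 sigma x -> enorm (x t) @[t --> +oo] --> (0 : R).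

End SwitchedSystem.

(* Main.v *)
Require Import Defs.
From mathcomp Require Import all_boot all_order all_algebra.
From mathcomp Require Import all_classical all_reals all_analysis.
From mathcomp Require Import ring lra.

Import Order.TTheory GRing.Theory Num.Theory.
Import numFieldNormedType.Exports.

Local Open Scope classical_set_scope.
Local Open Scope ring_scope.

(** Measure a solution x by N(t) = |P2^-1 x(t)|. In these coordinates mode 2 is
    a rotation scaled by exp(alpha2 s), so a stay of length s multiplies N by
    exactly exp(alpha2 s) ([solves_spiral]). Mode 1 becomes
    exp(-n1 t) (I + t u v^T), where u = (a, c) is the first column of M and v is
    orthogonal to u with |u| |v| = a^2 + c^2, because det M = 1 or -1. That is a
    shear, whose operator norm g solves g - 1/g = (a^2 + c^2) t; hence
    g = exp(asinh(ka t)) with ka = (a^2 + c^2) / 2 ([enorm_shear]), and a stay of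
    length t in mode 1 multiplies N by at most exp(-f(t)), where
    f(t) = n1 t - asinh(ka t).

    As sinh is convex on [0, +oo[ and vanishes at 0, asinh(x) / x is
    nonincreasing for x > 0, so f(t) / t is nondecreasing ([gap_ratio]). This
    single fact gives a linear estimate beyond any solution tau > 0 of
    f(tau) = alpha2 eta, namely f(t) >= (t / tau) alpha2 eta for t >= tau, and
    hence the uniqueness of tau.

    Consequently one cycle, of lengths t_k >= tau and s_k <= eta, multiplies N
    by at most exp(-alpha2 e_k), where
    e_k = (eta / tau) (t_k - tau) + (eta - s_k) >= 0 is the [slack] of the cycle
    ([cycle_decay]); inside a cycle N exceeds its initial value by a bounded
    factor only ([cycle_peak]). Stability follows. If moreover (t_k, s_k) does
    not converge to (tau, eta), then e_k does not tend to 0, so the series of the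
    e_k diverges to +oo, and N tends to 0. *)

Set Implicit Arguments.
Unset Strict Implicit.
Unset Printing Implicit Defensive.

(** * The inverse hyperbolic sine and the threshold equation *)

Section Hyperbolic.
Context {R : realType}.
Implicit Types (x v l t k n : R).

Lemma is_derive_expRM l x :
  is_derive x 1 (fun v => expR (l * v)) (l * expR (l * x)).
Proof.
have dl : is_derive x 1 ( *%R l) l.
  by apply: is_derive_eq (is_deriveZ l (is_derive_id x 1)) _; exact: mulr1.
by apply: is_derive_eq (is_derive1_comp (is_derive_expR _) dl) _; exact: mulrC.
Qed.

Lemma continuous_sinh : continuous (@sinh R).
Proof.
move=> x; apply: cvgMl.
apply: cvgB; first exact: continuous_expR.
apply: continuous_comp; first exact: opp_continuous.
exact: continuous_expR.
Qed.

Lemma sinh0 : sinh (0 : R) = 0.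
Proof. by rewrite /sinh oppr0 subrr mul0r. Qed.

Lemma ler_sinh : {mono @sinh R : x y / x <= y}.
Proof.
apply: le_mono => x y xy; rewrite /sinh ltr_pM2r ?invr_gt0//.
by rewrite ltrB ?ltr_expR ?ltrN2.
Qed.

(** At a fixed l, the difference of the two sides has derivative
    l (cosh (l v) - cosh v) >= 0 in v, and vanishes at v = 0. *)
Lemma sinh_starshaped l v : 1 <= l -> 0 <= v -> l * sinh v <= sinh (l * v).
Proof.
move=> l1 v0.
pose g w := sinh (l * w) - l * sinh w.
pose dg w := l * ((expR (l * w) + expR (- (l * w))) - (expR w + expR (- w))) / 2.
have gE : g = (fun w => 2^-1 * expR (l * w)) +
    ((fun w => - 2^-1 * expR (- l * w)) +
     ((fun w => (- l / 2) * expR (1 * w)) + (fun w => (l / 2) * expR (-1 * w)))).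
  by apply/funext => w; rewrite /g /sinh/= !fctE mulN1r mul1r !mulNr; lra.
have dgP (w : R) : is_derive w 1 g (dg w).
  have e c l' : is_derive w 1 (fun v => c * expR (l' * v)) (c * (l' * expR (l' * w))).
    by apply: is_derive_eq (is_deriveZ c (is_derive_expRM l' w)) _.
  rewrite gE; apply: is_derive_eq (is_deriveD (e _ _)
    (is_deriveD (e _ _) (is_deriveD (e _ _) (e _ _)))) _.
  by rewrite /dg (mul1r w) (mulN1r w) (mulNr l w); lra.
have [//|c c0v] := @MVT_segment R g dg 0 v v0 (fun w _ => dgP w).
  apply: continuous_subspaceT => w; apply: differentiable_continuous.
  by apply/derivable1_diffP; exact: (@ex_derive _ _ _ _ _ _ _ (dgP w)).
have c0 : 0 <= c by move: c0v; rewrite in_itv/= => /andP[].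
rewrite /g mulr0 sinh0 mulr0 !subr0 => gv.
rewrite -subr_ge0 gv mulr_ge0// /dg divr_ge0// mulr_ge0 ?(le_trans _ l1)//.
(* With p = e^c, q = e^(l c) and inverses p', q', the sign of dg c is that of
   q + q' - p - p' = (q - p) (1 - p' q'), where q >= p >= 1. *)
have e1 : 1 <= expR c by rewrite -expR0 ler_expR.
have e2 : expR c <= expR (l * c) by rewrite ler_expR; nra.
have := mulVf (lt0r_neq0 (expR_gt0 c)); have := mulVf (lt0r_neq0 (expR_gt0 (l * c))).
rewrite -!expRN.
have := expR_gt0 (- c); have := expR_gt0 (- (l * c)).
move: (expR c) (expR (l * c)) (expR (- c)) (expR (- (l * c))) e1 e2.
move=> p q p' q' p1 pq q'0 p'0 qq pp.
have : 0 <= (q - p) * (1 - q' * p').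
  rewrite mulr_ge0 ?subr_ge0//.
  have : p' <= 1 by nra.
  have : q' <= 1 by nra.
  nra.
have -> : (q - p) * (1 - q' * p') = q - p - (q' * q) * p' + (p' * p) * q' by ring.
rewrite qq pp; lra.
Qed.

Lemma asinh_ge0 x : 0 <= x -> 0 <= asinh x.
Proof.
move=> x0; rewrite /asinh ln_ge0//.
have : 1 <= Num.sqrt (x ^+ 2 + 1).
  by rewrite -[leLHS]sqrtr1 ler_wsqrtr// lerDr sqr_ge0.
lra.
Qed.

Lemma asinh_le_scale l x : 1 <= l -> 0 <= x -> asinh (l * x) <= l * asinh x.
Proof.
move=> l1 x0.
rewrite -ler_sinh asinhK -[X in l * X]asinhK.
exact: sinh_starshaped (asinh_ge0 x0).
Qed.

Lemma expR_asinh_le x : 0 <= x -> expR (asinh x) <= 2 * x + 1.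
Proof.
move=> x0; rewrite /asinh lnK; last first.
  by rewrite posrE ltr_wpDl ?sqrtr_gt0// ltr_wpDl ?sqr_ge0.
suff : Num.sqrt (x ^+ 2 + 1) <= x + 1 by lra.
by rewrite -[leRHS]ger0_norm; [rewrite -sqrtr_sqr ler_wsqrtr//; nra | lra].
Qed.

Lemma sinh_ge_sqr v : 0 <= v -> v ^+ 2 / 8 <= sinh v.
Proof.
move=> v0; have := expR_ge1Dxn 1 v0; rewrite /sinh.
have : expR (- v) <= 1 by rewrite -expR0 ler_expR; lra.
have -> : (2`!%:R : R) = 2 by [].
nra.
Qed.

(** The ratio (n t - asinh (k t)) / t is nondecreasing in t > 0, written as a
    lower bound for the later value. *)
Lemma gap_ratio n k t t' : 0 <= k -> 0 < t <= t' ->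
  t' / t * (n * t - asinh (k * t)) <= n * t' - asinh (k * t').
Proof.
move=> k0 /andP[t0 tt'].
have l1 : 1 <= t' / t by rewrite ler_pdivlMr// mul1r.
have := asinh_le_scale l1 (mulr_ge0 k0 (ltW t0)).
have -> : t' / t * (k * t) = k * t' by field; rewrite gt_eqF.
rewrite mulrBr.
have -> : t' / t * (n * t) = n * t' by field; rewrite gt_eqF.
lra.
Qed.

(** The substitution t = sinh v / k turns the equation into
    (n / k) sinh v - v = q, whose left-hand side is visibly continuous and
    outgrows every constant, so that the intermediate value theorem applies.
    Uniqueness comes from [gap_ratio]: past a solution the left-hand side is at
    least q times a factor greater than 1. *)
Lemma gap_solution n k q : 0 < n -> 0 < k -> 0 < q ->
  exists tau, unique (fun t => 0 < t /\ q = n * t - asinh (k * t)) tau.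
Proof.
move=> n0 k0 q0.
(* V is large enough for the bound sinh V >= V^2 / 8 to give
   (n / k) sinh V >= 2 V >= V + q. *)
pose V := q + 16 * k / n.
pose h v := n / k * sinh v - v.
have kn0 : 0 < 16 * k / n by rewrite divr_gt0// mulr_gt0.
have V0 : 0 <= V by rewrite /V; lra.
have hV : q <= h V.
  have := sinh_ge_sqr V0.
  rewrite -(ler_pM2l (divr_gt0 n0 k0)).
  have : 2 * V <= n / k * (V ^+ 2 / 8).
    have -> : n / k * (V ^+ 2 / 8) = V * (n / k * q / 8 + 2).
      by rewrite /V; field; rewrite !gt_eqF.
    rewrite [leLHS]mulrC ler_wpM2l//.
    have : 0 < n / k * q / 8 by rewrite !(divr_gt0, mulr_gt0).
    lra.
  rewrite /h /V; lra.
have h0 : h 0 = 0 by rewrite /h sinh0 mulr0 subrr.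
have [||v] := @IVT R h 0 V q V0.
- apply: continuous_subspaceT => x; apply: cvgB; last exact: cvg_id.
  by apply: cvgMr; exact: continuous_sinh.
- by rewrite h0 ge_min le_max (ltW q0) hV orbT.
rewrite in_itv/= => /andP[v0 _] hv.
have v_gt0 : 0 < v.
  by rewrite lt_neqAle v0 andbT; apply: contraTneq q0 => v00; rewrite -hv -v00 h0 ltxx.
have s0 : 0 < sinh v.
  by have := sinh_ge_sqr v0; apply: lt_le_trans; rewrite divr_gt0// exprn_gt0.
pose tau := sinh v / k.
have tau0 : 0 < tau by rewrite divr_gt0.
have tauE : q = n * tau - asinh (k * tau).
  have -> : k * tau = sinh v by rewrite mulrC divfK ?gt_eqF.
  by rewrite sinhK -hv /h /tau mulrA mulrAC.
have incr t t' : 0 < t -> t < t' -> q = n * t - asinh (k * t) ->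
    q < n * t' - asinh (k * t').
  move=> t0 tt' tE; have := @gap_ratio n k t t' (ltW k0).
  rewrite t0 (ltW tt') -tE => /(_ isT); apply: lt_le_trans.
  by rewrite -[ltLHS]mul1r ltr_pM2r// ltr_pdivlMr// mul1r.
exists tau; split => // t [t0 tE].
by case: (ltgtP tau t) => // [/(incr _ _ tau0)/(_ tauE)|/(incr _ _ t0)/(_ tE)]; lra.
Qed.

End Hyperbolic.

(** * Entrywise calculus of matrix-valued functions *)

Section MatrixCalculus.
Context {R : realType}.
Implicit Types (t : R).

Lemma continuous_mulmx m n p (B : 'M[R]_(m, n)) :
  continuous (mulmx B : 'M[R]_(n, p) -> 'M[R]_(m, p)).
Proof.
have ctsij i j : continuous (fun u : 'M[R]_(n, p) => (B *m u) i j).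
  have -> : (fun u : 'M[R]_(n, p) => (B *m u) i j) =
            (fun u => \sum_k B i k * u k j).
    by apply/funext => u; rewrite mxE.
  apply: continuous_big => [|k _ u]; first exact: add_continuous.
  apply: (@continuous_comp _ _ _ (fun v : 'M[R]_(n, p) => v k j) ( *%R (B i k))).
    exact: coord_continuous.
  exact: mulrl_continuous.
move=> u S [P uP PS].
apply: (@filterS _ (nbhs u) _ [set v | forall i j, P i j ((B *m v) i j)]).
  by move=> v; exact: PS.
have Pij i j : nbhs u [set v | P i j ((B *m v) i j)].
  exact: (ctsij i j u _ (uP i j)).
have Pi i := @filter_forall _ _ _ _ (nbhs_filter u) (Pij i).
exact: (@filter_forall _ _ _ _ (nbhs_filter u) Pi).
Qed.

Lemma is_derive_entry m n (x : R -> 'M[R]_(m, n)) t v i j :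
  is_derive t 1 x v -> is_derive t 1 (fun s => x s i j) (v i j).
Proof.
move=> [dx <-]; have dxi := (derivable_mxP x t 1).1 dx i j.
by apply: DeriveDef => //; rewrite derive_mx// mxE.
Qed.

Lemma is_derive_mulmx m n p (B : 'M[R]_(m, n)) (x : R -> 'M[R]_(n, p)) t v :
  is_derive t 1 x v -> is_derive t 1 (fun s => B *m x s) (B *m v).
Proof.
move=> dx.
have dij i j : is_derive t 1 (fun s => (B *m x s) i j) ((B *m v) i j).
  have -> : (fun s => (B *m x s) i j) = \sum_k (B i k \*: (fun s => x s k j)).
    by apply/funext => s; rewrite fct_sumE mxE.
  rewrite mxE; apply: is_derive_sum => k.
  exact/is_deriveZ/is_derive_entry.
have D : derivable (fun s => B *m x s) t 1.
  by apply/derivable_mxP => i j; apply: (@ex_derive _ _ _ _ _ _ _ (dij i j)).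
apply: DeriveDef => //; rewrite derive_mx//; apply/matrixP => i j.
by rewrite mxE; apply: derive_val.
Qed.

Lemma within_continuous_entry m n (x : R -> 'M[R]_(m, n)) (D : set R) i j :
  {within D, continuous x} -> {within D, continuous (fun t => x t i j)}.
Proof.
move=> cx; apply: (@within_continuous_comp _ _ _ _ x (fun u => u i j)) => // u _.
exact: coord_continuous.
Qed.

End MatrixCalculus.

(** * The norms of the two flows *)

Section Flows.
Context {R : realType}.
Implicit Types (u : 'cV[R]_2) (t T : R).

(** A solution on one stay: continuity up to the endpoints, the equation only
    between them, since a switched solution need not be differentiable there. *)
Definition solves n (J : 'M[R]_n) (y : R -> 'cV[R]_n) (t0 t1 : R) :=
  {within `[t0, t1], continuous y} /\
  forall t, t \in `]t0, t1[ -> is_derive t 1 y (J *m y t).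

Lemma solves_conj n (J P : 'M[R]_n) x t0 t1 : P \in unitmx ->
  solves (P *m J *m invmx P) x t0 t1 ->
  solves J (fun t => invmx P *m x t) t0 t1.
Proof.
move=> uP [cx dx]; split.
  apply: (@within_continuous_comp _ _ _ _ x (mulmx (invmx P))) => // u _.
  exact: continuous_mulmx.
move=> t tt; have := is_derive_mulmx (invmx P) (dx t tt).
by rewrite !mulmxA mulVmx// mul1mx.
Qed.

Lemma solves_le n (J : 'M[R]_n) y t0 t1 t :
  t <= t1 -> solves J y t0 t1 -> solves J y t0 t.
Proof.
move=> tt [cy dy]; split.
  by apply: continuous_subspaceW cy; apply: subset_itvl; rewrite bnd_simp.
move=> s; rewrite in_itv/= => /andP[ts st]; apply: dy.
by rewrite in_itv/= ts (lt_le_trans st).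
Qed.

(** The function exp(-l t) f(t) has zero derivative, hence is constant. *)
Lemma linear_ode_expR (f : R -> R) l t0 t1 : t0 <= t1 ->
  {within `[t0, t1], continuous f} ->
  (forall t, t \in `]t0, t1[ -> is_derive t 1 f (l * f t)) ->
  f t1 = expR (l * (t1 - t0)) * f t0.
Proof.
move=> t01 cf df.
pose e t := expR (- l * t).
have de t : is_derive t 1 e (- l * e t) := is_derive_expRM (- l) t.
have [||c _] := @MVT_segment R (e * f) (fun=> 0) t0 t1 t01.
- move=> t tt; apply: is_derive_eq (is_deriveM (de t) (df t tt)) _.
  by rewrite /GRing.scale/=; ring.
- move=> t; apply: continuousM; last exact: cf.
  apply: continuous_subspaceT => s; apply: differentiable_continuous.
  by apply/derivable1_diffP; exact: (@ex_derive _ _ _ _ _ _ _ (de s)).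
rewrite mul0r => /eqP; rewrite subr_eq0 => /eqP.
rewrite !fctE/= /e => E.
have -> : expR (l * (t1 - t0)) = expR (l * t1) * expR (- l * t0).
  by rewrite -expRD; congr expR; ring.
by rewrite -mulrA -E mulrA -expRD mulNr subrr expR0 mul1r.
Qed.

Lemma enorm_ge0 n (u : 'cV[R]_n) : 0 <= enorm u.
Proof. exact: sqrtr_ge0. Qed.

Lemma enormZ n k (u : 'cV[R]_n) : enorm (k *: u) = `|k| * enorm u.
Proof.
rewrite /enorm -sqrtr_sqr -sqrtrM ?sqr_ge0// mulr_sumr.
by congr Num.sqrt; apply: eq_bigr => i _; rewrite mxE exprMn.
Qed.

Lemma sum_ord2 (F : 'I_2 -> R) : \sum_i F i = F 0 + F 1.
Proof. by rewrite big_ord_recl big_ord1; congr (_ + F _); apply/val_inj. Qed.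

Lemma enorm2 (u : 'cV[R]_2) : enorm u = Num.sqrt (u 0 0 ^+ 2 + u 1 0 ^+ 2).
Proof. by rewrite /enorm sum_ord2. Qed.

Lemma enorm_mulmx_le (B : 'M[R]_2) :
  exists2 C : R, 0 < C & forall u : 'cV[R]_2, enorm (B *m u) <= C * enorm u.
Proof.
pose C2 : R := B 0 0 ^+ 2 + B 0 1 ^+ 2 + B 1 0 ^+ 2 + B 1 1 ^+ 2.
have C20 : 0 <= C2 by rewrite !addr_ge0 ?sqr_ge0.
exists (Num.sqrt (C2 + 1)) => [|u]; first by rewrite sqrtr_gt0; lra.
rewrite !enorm2 -sqrtrM; last by lra.
apply: ler_wsqrtr; rewrite !mxE !sum_ord2.
set p := B 0 0; set q := B 0 1; set r := B 1 0; set s := B 1 1.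
set u0 := u 0 0; set u1 := u 1 0.
(* Cauchy-Schwarz in the form of Lagrange's identity, once for each row of B. *)
rewrite -subr_ge0 [leRHS](_ : _ = (p * u1 - q * u0) ^+ 2 +
  (r * u1 - s * u0) ^+ 2 + u0 ^+ 2 + u1 ^+ 2); first by rewrite !addr_ge0 ?sqr_ge0.
rewrite /C2 -/p -/q -/r -/s; ring.
Qed.

Lemma mx22_mulE p q r s (u : 'cV[R]_2) :
  ((mx22 p q r s *m u) 0 0 = p * u 0 0 + q * u 1 0) *
  ((mx22 p q r s *m u) 1 0 = r * u 0 0 + s * u 1 0).
Proof. by split; rewrite mxE sum_ord2 !mxE. Qed.

(** The squared norm satisfies f' = 2 al f, the rotation part cancelling. *)
Lemma solves_spiral (al be : R) y t0 t1 : t0 <= t1 ->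
  solves (mx22 al be (- be) al) y t0 t1 ->
  enorm (y t1) = expR (al * (t1 - t0)) * enorm (y t0).
Proof.
move=> t01 [cy dy].
pose g i := fun t => y t i 0.
pose f := g 0 * g 0 + g 1 * g 1.
have : f t1 = expR (2 * al * (t1 - t0)) * f t0.
  apply: linear_ode_expR t01 _ _.
    have cc i := @within_continuous_entry _ _ _ _ _ i 0 cy.
    by apply: within_continuousD => t; apply: continuousM; exact: cc.
  move=> t tt; have dd i := is_derive_entry i 0 (dy t tt).
  apply: is_derive_eq (is_deriveD (is_deriveM (dd 0) (dd 0))
                                  (is_deriveM (dd 1) (dd 1))) _.
  by rewrite !mx22_mulE /f /g !fctE /GRing.scale/=; ring.
have fE t : f t = y t 0 0 ^+ 2 + y t 1 0 ^+ 2 by [].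
rewrite !enorm2 -!fE => ->.
rewrite sqrtrM ?expR_ge0//; congr (_ * _).
have -> : 2 * al * (t1 - t0) = al * (t1 - t0) + al * (t1 - t0) by ring.
by rewrite expRD -expr2 sqrtr_sqr ger0_norm// expR_ge0.
Qed.

(** Both z_2 and z_1 - (t - t0) z_2 satisfy the scalar equation f' = - n f. *)
Lemma solves_jordan (n : R) z t0 t1 : t0 <= t1 ->
  solves (mx22 (- n) 1 0 (- n)) z t0 t1 ->
  z t1 = expR (- n * (t1 - t0)) *: (mx22 1 (t1 - t0) 0 1 *m z t0).
Proof.
move=> t01 [cz dz].
have cc i := @within_continuous_entry _ _ _ _ _ i 0 cz.
have z2 : z t1 1 0 = expR (- n * (t1 - t0)) * z t0 1 0.
  apply: (@linear_ode_expR (fun t => z t 1 0)) t01 _ _ => // t tt.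
  apply: is_derive_eq (is_derive_entry 1 0 (dz t tt)) _.
  by rewrite mx22_mulE; ring.
pose f := (fun t => z t 0 0) - (fun t => t - t0) * (fun t => z t 1 0).
have : f t1 = expR (- n * (t1 - t0)) * f t0.
  apply: linear_ode_expR t01 _ _.
    apply: within_continuousB; first exact: cc.
    move=> t; apply: continuousM; last exact: cc.
    by apply: continuous_subspaceT => s; apply: cvgB; [exact: cvg_id|exact: cvg_cst].
  move=> t tt; have dd i := is_derive_entry i 0 (dz t tt).
  have d0 : is_derive t 1 (fun s : R => s - t0) 1.
    apply: is_derive_eq (is_deriveB (is_derive_id t 1) (is_derive_cst t0 t 1)) _.
    exact: subr0.
  apply: is_derive_eq (is_deriveB (dd 0) (is_deriveM d0 (dd 1))) _.
  by rewrite !mx22_mulE /f !fctE /GRing.scale/=; ring.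
rewrite /f !fctE/= z2 => fE.
apply/matrixP => i j; rewrite ord1 [RHS]mxE {j}.
have [->|->] : i = 0 \/ i = 1.
- by case: i => -[|[|//]] ?; [left|right]; apply/val_inj.
- by rewrite mx22_mulE; lra.
- by rewrite mx22_mulE z2; ring.
Qed.

Lemma det_mx22 (a b c d : R) : \det (mx22 a b c d) = a * d - b * c.
Proof.
rewrite (expand_det_row _ 0) sum_ord2 /cofactor !det_mx11 !mxE/= expr0 expr1.
ring.
Qed.

Lemma unimodular_sqr_det (a b c d : R) :
  \det (mx22 a b c d) = 1 \/ \det (mx22 a b c d) = -1 ->
  (a * d - b * c) ^+ 2 = 1.
Proof. by rewrite det_mx22 => -[->|->]; rewrite ?sqrrN expr1n. Qed.

Lemma unimodular_col_gt0 (a b c d : R) :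
  \det (mx22 a b c d) = 1 \/ \det (mx22 a b c d) = -1 -> 0 < a ^+ 2 + c ^+ 2.
Proof.
move=> /unimodular_sqr_det D2.
have m0 : 0 <= a ^+ 2 + c ^+ 2 by rewrite addr_ge0 ?sqr_ge0.
rewrite lt_neqAle m0 andbT; apply/eqP => /esym mE.
have : (a * d - b * c) ^+ 2 <= (a ^+ 2 + c ^+ 2) * (b ^+ 2 + d ^+ 2).
  rewrite -subr_ge0 [leRHS](_ : _ = (a * b + c * d) ^+ 2) ?sqr_ge0//; ring.
by rewrite D2 mE mul0r ler10.
Qed.

(** Let (p, w) be the coordinates of M u in the orthogonal frame given by (a, c)
    and its quarter turn, both scaled by the length of (a, c). The step of length
    T changes them to (p + r u_1, w), where r = (a^2 + c^2) T and w = u_1 or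
    - u_1: it is a shear by r. If r = g - 1/g then
    g^2 (p^2 + w^2) - (p + r u_1)^2 - w^2 = r (g p - u_1)^2 / g >= 0. *)
Lemma enorm_shear (a b c d T : R) u : 0 <= T ->
  \det (mx22 a b c d) = 1 \/ \det (mx22 a b c d) = -1 ->
  enorm (mx22 a b c d *m (mx22 1 T 0 1 *m u)) <=
    expR (asinh ((a ^+ 2 + c ^+ 2) / 2 * T)) * enorm (mx22 a b c d *m u).
Proof.
move=> T0 detM.
have D2 := unimodular_sqr_det detM.
set m := a ^+ 2 + c ^+ 2.
have m0 : 0 < m := unimodular_col_gt0 detM.
set g := expR _.
have g0 : 0 < g by exact: expR_gt0.
have gE : g - g^-1 = m * T.
  have := asinhK (m / 2 * T); rewrite /sinh expRN -/g; lra.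
have gsqr : g = Num.sqrt (g ^+ 2) by rewrite sqrtr_sqr ger0_norm// ltW.
rewrite !enorm2 !mx22_mulE {1}gsqr -sqrtrM ?sqr_ge0//.
apply: ler_wsqrtr.
rewrite -(ler_pM2l m0).
set u0 := u 0 0; set u1 := u 1 0.
pose p := a * (a * u0 + b * u1) + c * (c * u0 + d * u1).
pose w := (a * d - b * c) * u1.
have w2 : w ^+ 2 = u1 ^+ 2 by rewrite /w exprMn D2 mul1r.
pose r := m * T.
have Tr : r = g - g^-1 by rewrite gE.
rewrite [leLHS](_ : _ = (p + r * u1) ^+ 2 + w ^+ 2); last first.
  by rewrite /p /r /w /m; ring.
rewrite [leRHS](_ : _ = g ^+ 2 * (p ^+ 2 + w ^+ 2)); last first.
  by rewrite /p /w /m; ring.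
rewrite w2 -subr_ge0.
have -> : g ^+ 2 * (p ^+ 2 + u1 ^+ 2) - ((p + r * u1) ^+ 2 + u1 ^+ 2) =
    r * ((g * p - u1) ^+ 2 / g).
  by rewrite Tr; field; rewrite gt_eqF.
have r0 : 0 <= r by rewrite mulr_ge0// ltW.
by rewrite mulr_ge0// divr_ge0 ?sqr_ge0// ltW.
Qed.

End Flows.

(** * Modes of a switching signal *)

Section Signals.
Context {R : realType}.
Implicit Types (sigma : R -> bool) (d : R^nat) (tau eta s t : R) (k : nat).

Lemma nbhs_bool (b : bool) (F : set_system bool) : F --> b -> F [set b].
Proof. by apply; rewrite nbhs_principalE. Qed.

Lemma switching_times_homo sigma d : switching_times sigma d ->
  {homo d : i j / (i <= j)%N >-> i <= j}.
Proof. by move=> [[_ dlt _] _]; apply/nondecreasing_seqP => k; exact: ltW. Qed.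

Lemma switching_times_ge0 sigma d k : switching_times sigma d -> 0 <= d k.
Proof.
by move=> H; case: (H) => [[<- _ _] _]; apply: switching_times_homo H _ _ _.
Qed.

(** On an open stay the signal is constant, and right continuity at its start
    identifies that constant. *)
Lemma signal_stay sigma d k t : switching_times sigma d ->
  d k <= t < d k.+1 -> sigma t = sigma (d k).
Proof.
move=> H; have dk0 := switching_times_ge0 k H.
case: H => [[_ dlt _] [rc cst _]] /andP[].
rewrite le_eqVlt => /predU1P[<-//|kt] tk.
have := nbhs_bool (rc _ dk0) => rcn.
have [s /= [ss ks]] : exists s, sigma s = sigma (d k) /\ d k < s < d k.+1.
  have : \forall s \near (d k)^'+, sigma s = sigma (d k) /\ d k < s < d k.+1.
    near=> s; split; first by near: s; exact: rcn.
    by apply/andP; split; near: s; [exact: nbhs_right_gt|exact: nbhs_right_lt].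
  by move=> /(@filter_ex _ _ (at_right_proper_filter (d k))).
by rewrite -ss; apply: (cst k) => //; rewrite kt.
Unshelve. all: by end_near. Qed.

(** If the two modes agreed, the signal would be constant around d k.+1, hence
    continuous there. *)
Lemma signal_switch sigma d k : switching_times sigma d ->
  sigma (d k.+1) = ~~ sigma (d k).
Proof.
move=> H; have stay i := @signal_stay _ _ i _ H.
case: H => [[_ dlt _] [_ _ /(_ k) disc]].
case: (sigma (d k.+1) =P ~~ sigma (d k)) => // ne; exfalso; apply: disc.
have E : sigma (d k.+1) = sigma (d k) by move: ne; do 2 case: (sigma _).
apply: (near_cst_continuous (sigma (d k.+1))).
near=> s; have : s \in `]d k, d k.+2[.
  by near: s; apply: near_in_itvoo; rewrite in_itv/= !dlt.
rewrite in_itv/= => /andP[ks sk]; case: (ltP s (d k.+1)) => sk1.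
  by rewrite E; apply: stay; rewrite (ltW ks).
by apply: stay; rewrite sk1.
Unshelve. all: by end_near. Qed.

Lemma signal_mode sigma d k t : switching_times sigma d -> sigma 0 = true ->
  d k <= t < d k.+1 -> sigma t = ~~ odd k.
Proof.
move=> H s0 /(signal_stay H) ->; elim: k => [|k IH].
  by case: H => [[-> _ _] _].
by rewrite (signal_switch _ H) IH.
Qed.

Lemma signal_solves (A1 A2 : 'M[R]_2) sigma d (x : R -> 'cV[R]_2) k :
  switching_times sigma d -> sigma 0 = true -> solution A1 A2 sigma x ->
  solves (if odd k then A2 else A1) x (d k) (d k.+1).
Proof.
move=> H s0 [cx dx]; have dk0 := switching_times_ge0 k H; split.
  apply: continuous_subspaceW cx => t /=; rewrite !in_itv/= andbT => /andP[+ _].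
  exact: le_trans.
move=> t /[dup] tk; rewrite in_itv/= => /andP[kt tk1].
have st s : s \in `]d k, d k.+1[ -> sigma s = ~~ odd k.
  by rewrite in_itv/= => /andP[? ?]; apply: signal_mode H s0 _; rewrite ltW.
have := dx t (le_lt_trans dk0 kt).
rewrite st// if_neg; apply.
apply: (near_cst_continuous (~~ odd k)).
by near=> s; apply: st; near: s; exact: near_in_itvoo.
Unshelve. all: by end_near. Qed.

Lemma signal_locate sigma d t : switching_times sigma d -> 0 <= t ->
  exists k, d k <= t < d k.+1.
Proof.
move=> [[d0 _ /cvgryPgt/(_ t)[N _ Nt]] _] t0.
have ex : exists n, t < d n by exists N; apply: (Nt N) => /=.
case: (ex_minnP ex) => -[|k]; first by rewrite d0 ltNge t0.
move=> tk min; exists k; rewrite tk andbT leNgt; apply/negP => /min.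
by rewrite ltnn.
Qed.

Lemma signal_locate_cycle sigma d t : switching_times sigma d -> 0 <= t ->
  exists k, d k.*2 <= t < d k.+1.*2.
Proof.
move=> H /(signal_locate H)[n /andP[nt tn]]; have hd := switching_times_homo H.
exists n./2; rewrite (le_trans (hd _ _ _) nt) ?(lt_le_trans tn (hd _ _ _))//.
  rewrite doubleS -{1}(odd_double_half n).
  by case: odd => /=; rewrite ?add0n ltnS// leqnSn.
by rewrite -{2}(odd_double_half n) leq_addl.
Qed.

End Signals.

(** * Decay over the cycles of a signal *)

Section Cycles.
Context {R : realType} (n ka al tau eta : R).
Context (n0 : 0 < n) (ka0 : 0 < ka) (al0 : 0 < al) (tau0 : 0 < tau) (eta0 : 0 < eta).
Context (tauE : al * eta = n * tau - asinh (ka * tau)).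
Context (sigma : R -> bool) (d : R^nat) (Hd : switching_times sigma d).
Context (dP : forall k, tau <= time1 d k /\ time2 d k <= eta).

(** The excess of the k-th cycle over the extremal lengths (tau, eta), weighted
    so that al times it bounds from below the logarithmic decay over the cycle. *)
Definition slack k := eta / tau * (time1 d k - tau) + (eta - time2 d k).

Lemma slack_ge0 k : 0 <= slack k.
Proof.
have [t1 t2] := dP k; rewrite addr_ge0 ?subr_ge0// mulr_ge0 ?subr_ge0//.
by rewrite divr_ge0// ltW.
Qed.

(** Both terms of the slack are nonnegative, so each of them tends to 0 when the
    terms of a convergent series do. *)
Lemma slack_cvg : cvgn (series slack) ->
  (time1 d k, time2 d k) @[k --> \oo] --> (tau, eta).
Proof.
move=> /cvg_series_cvg_0 s0.
have c1 : time1 d k @[k --> \oo] --> tau.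
  apply: (@squeeze_cvgr _ _ _ _ (cst tau) (fun k => tau + tau / eta * slack k)).
  - near=> k; have [t1 t2] := dP k; rewrite /= t1/= /slack.
    rewrite -lerBlDl [leLHS](_ : _ = tau / eta * (eta / tau * (time1 d k - tau)));
      last first.
      by field; rewrite !gt_eqF.
    by rewrite ler_wpM2l ?divr_ge0 ?(ltW eta0) ?(ltW tau0)// lerDl subr_ge0.
  - exact: cvg_cst.
  - rewrite -[X in _ --> X]addr0 -[X in _ --> _ + X](mulr0 (tau / eta)).
    by apply: cvgD; [exact: cvg_cst|exact: (cvgMr s0)].
suff c2 : time2 d k @[k --> \oo] --> eta by exact: (cvg_pair c1 c2).
apply: (@squeeze_cvgr _ _ _ _ (fun k => eta - slack k) (cst eta)).
- near=> k; have [t1 t2] := dP k; rewrite /= t2 andbT /slack.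
  have : 0 <= eta / tau * (time1 d k - tau).
    by rewrite mulr_ge0 ?subr_ge0// divr_ge0// ltW.
  lra.
- rewrite -[X in _ --> X]subr0; apply: cvgB => //; exact: cvg_cst.
- exact: cvg_cst.
Unshelve. all: by end_near. Qed.

(* N stands for the norm of a solution in the coordinates where mode 2 is a
   scaled rotation. *)
Context (N : R -> R) (N_ge0 : forall t, 0 <= N t).
Context (N1 : forall k t, d k.*2 <= t <= d k.*2.+1 ->
  N t <= expR (- n * (t - d k.*2)) * expR (asinh (ka * (t - d k.*2))) * N (d k.*2)).
Context (N2 : forall k t, d k.*2.+1 <= t <= d k.*2.+2 ->
  N t <= expR (al * (t - d k.*2.+1)) * N (d k.*2.+1)).

Let dS k : d k <= d k.+1.
Proof. by apply: (switching_times_homo Hd). Qed.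

(** The gain is at most exp(al s_k - f(t_k)) with f(t) = n t - asinh (ka t), and
    f(t_k) >= (t_k / tau) f(tau) = (t_k / tau) al eta. *)
Lemma cycle_step k : N (d k.+1.*2) <= expR (- al * slack k) * N (d k.*2).
Proof.
have [t1 t2] := dP k.
have := N2 (k := k) (t := d k.*2.+2); rewrite dS lexx => /(_ isT).
have := N1 (k := k) (t := d k.*2.+1); rewrite dS lexx => /(_ isT).
rewrite -/(time1 d k) -/(time2 d k) doubleS => h1 h2.
apply: (le_trans h2); apply: (le_trans (ler_wpM2l (expR_ge0 _) h1)).
rewrite mulrA ler_wpM2r// -!expRD ler_expR.
have := @gap_ratio R n ka tau (time1 d k) (ltW ka0).
rewrite tau0 t1 -tauE => /(_ isT).
have -> : time1 d k / tau * (al * eta) =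
    al * eta + al * (eta / tau * (time1 d k - tau)).
  by field; rewrite gt_eqF.
rewrite /slack; lra.
Qed.

Lemma cycle_decay k : N (d k.*2) <= expR (- al * series slack k) * N (d 0%N).
Proof.
elim: k => [|k IH]; first by rewrite seriesEnat/= big_geq// mulr0 expR0 mul1r.
apply: (le_trans (cycle_step k)); apply: (le_trans (ler_wpM2l (expR_ge0 _) IH)).
rewrite mulrA ler_wpM2r// -expRD ler_expR !seriesEnat/= big_nat_recr//=.
by rewrite -mulrDr addrC.
Qed.

(** In the first stay exp(asinh (ka T)) <= 2 ka T + 1 grows linearly only, which
    exp(- n T) compensates; the second stay lasts at most eta. *)
Lemma cycle_peak k t : d k.*2 <= t <= d k.+1.*2 ->
  N t <= (2 * ka / n + 1) * expR (al * eta) * N (d k.*2).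
Proof.
have [_ t2] := dP k.
set K := 2 * ka / n + 1.
have K0 : 0 <= K by rewrite addr_ge0// divr_ge0 ?mulr_ge0 ?ltW.
have e1 : 1 <= expR (al * eta) by rewrite -expR0 ler_expR mulr_ge0 ?ltW.
have b1 s : d k.*2 <= s <= d k.*2.+1 -> N s <= K * N (d k.*2).
  move=> /[dup] /N1 /le_trans + /andP[s0 _]; apply.
  rewrite ler_wpM2r//; set T := s - _.
  have T0 : 0 <= T by rewrite subr_ge0.
  have := @expR_asinh_le R (ka * T) (mulr_ge0 (ltW ka0) T0).
  move/(ler_wpM2l (expR_ge0 (- n * T)))/le_trans; apply.
  rewrite mulNr expRN mulrC ler_pdivrMr ?expR_gt0//.
  have nT : 1 + n * T <= expR (n * T) by exact: expR_ge1Dx.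
  apply: (@le_trans _ _ (K * (1 + n * T))); last exact: ler_wpM2l.
  have -> : K * (1 + n * T) = (2 * (ka * T) + 1) + (2 * ka / n + n * T).
    by rewrite /K; field; rewrite gt_eqF.
  rewrite lerDl addr_ge0 ?(mulr_ge0 (ltW n0) T0)//.
  by rewrite divr_ge0 ?mulr_ge0 ?ltW.
move=> /andP[t0 tt]; case: (lerP t (d k.*2.+1)) => tm.
  apply: (le_trans (b1 t _)); first by rewrite t0.
  by rewrite mulrAC ler_peMr// mulr_ge0.
have /N2 : d k.*2.+1 <= t <= d k.*2.+2 by rewrite (ltW tm).
move/le_trans; apply.
rewrite [K * _]mulrC -mulrA ler_pM ?expR_ge0//.
  rewrite ler_expR ler_wpM2l ?(ltW al0)//; move: t2; rewrite /time2.
  move: tt; rewrite doubleS; lra.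
by apply: b1; rewrite dS lexx.
Qed.

End Cycles.

Section SwitchedSystem.
Context {R : realType} (A1 A2 P1 P2 : 'M[R]_2).
Context (n1 alpha2 beta2 a b c d eta tau : R).
Context (n1_gt0 : 0 < n1) (alpha2_gt0 : 0 < alpha2)
  (P1_unit : P1 \in unitmx) (P2_unit : P2 \in unitmx)
  (A1E : A1 = P1 *m mx22 (- n1) 1 0 (- n1) *m invmx P1)
  (A2E : A2 = P2 *m mx22 alpha2 beta2 (- beta2) alpha2 *m invmx P2)
  (ME : invmx P2 *m P1 = mx22 a b c d)
  (detM : \det (mx22 a b c d) = 1 \/ \det (mx22 a b c d) = -1)
  (eta_gt0 : 0 < eta) (tau_gt0 : 0 < tau)
  (tauE : alpha2 * eta = n1 * tau - asinh ((a ^+ 2 + c ^+ 2) / 2 * tau)).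

(** Only the coordinates y = P2^-1 x are followed through the cycles. In mode 1,
    y = M z with z = P1^-1 x, where z has the explicit Jordan flow. The constant
    also pays for the change of norm from x to y and back. *)
Lemma solution_decay : exists2 C : R, 0 < C &
  forall sigma (dk : R^nat), switching_times sigma dk -> sigma 0 = true ->
    (forall k, tau <= time1 dk k /\ time2 dk k <= eta) ->
  forall x, solution A1 A2 sigma x ->
  forall k t, dk k.*2 <= t <= dk k.+1.*2 ->
  enorm (x t) <= C * expR (- alpha2 * series (slack tau eta dk) k) * enorm (x 0).
Proof.
set ka := (a ^+ 2 + c ^+ 2) / 2.
have ka0 : 0 < ka by rewrite divr_gt0// (unimodular_col_gt0 detM).
have [C1 C10 hC1] := enorm_mulmx_le P2.
have [C2 C20 hC2] := enorm_mulmx_le (invmx P2).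
pose K := (2 * ka / n1 + 1) * expR (alpha2 * eta).
have K0 : 0 < K.
  by rewrite mulr_gt0 ?expR_gt0// addr_gt0// divr_gt0// mulr_gt0.
exists (C1 * K * C2) => [|sigma dk Hd s0 dP x Hx k t kt].
  exact: mulr_gt0 (mulr_gt0 C10 K0) C20.
pose N s := enorm (invmx P2 *m x s).
have d00 : dk 0%N = 0 by case: Hd => [[]].
have N1 j s : dk j.*2 <= s <= dk j.*2.+1 ->
    N s <= expR (- n1 * (s - dk j.*2)) * expR (asinh (ka * (s - dk j.*2))) * N (dk j.*2).
  move=> /andP[js sj].
  have := signal_solves j.*2 Hd s0 Hx.
  rewrite odd_double => /(solves_le sj); rewrite A1E => /(solves_conj P1_unit) Hz.
  have xz r : invmx P2 *m x r = mx22 a b c d *m (invmx P1 *m x r).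
    by rewrite -ME -mulmxA mulKVmx.
  rewrite /N !xz (solves_jordan js Hz) -scalemxAr enormZ ger0_norm ?expR_ge0//.
  by rewrite -mulrA ler_wpM2l ?expR_ge0// enorm_shear// subr_ge0.
have N2 j s : dk j.*2.+1 <= s <= dk j.*2.+2 ->
    N s <= expR (alpha2 * (s - dk j.*2.+1)) * N (dk j.*2.+1).
  move=> /andP[js sj].
  have := signal_solves j.*2.+1 Hd s0 Hx.
  rewrite /= odd_double => /(solves_le sj); rewrite A2E => /(solves_conj P2_unit) Hz.
  by rewrite /N (solves_spiral js Hz).
have N0 s : 0 <= N s by exact: enorm_ge0.
have peak : N t <= K * N (dk k.*2).
  exact: (cycle_peak n1_gt0 ka0 alpha2_gt0 eta_gt0 Hd dP N0 N1 N2 kt).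
have decay := cycle_decay ka0 tau_gt0 tauE Hd dP N0 N1 N2 k.
clearbody K.
rewrite -[x t](mulKVmx P2_unit); apply: (le_trans (hC1 _)).
rewrite -!mulrA ler_wpM2l ?(ltW C10)//.
apply: (le_trans peak); rewrite ler_wpM2l ?(ltW K0)//.
apply: (le_trans decay); rewrite mulrCA ler_wpM2l ?expR_ge0// d00.
exact: hC2.
Qed.

Lemma signals_stable sigma : signals tau eta sigma -> stable A1 A2 sigma.
Proof.
have [C C0 decay] := solution_decay => -[dk [Hd s0 dP]] e e0.
exists (e / C) => [|x Hx x0 t t0]; first exact: divr_gt0.
have [k /andP[kt tk]] := signal_locate_cycle Hd (ltW t0).
have kt' : dk k.*2 <= t <= dk k.+1.*2 by rewrite kt ltW.
apply: (le_lt_trans (decay _ _ Hd s0 dP x Hx k t kt')).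
move: x0; rewrite ltr_pdivlMr// mulrC; apply: le_lt_trans.
rewrite -mulrA ler_wpM2l ?(ltW C0)// ler_piMl ?enorm_ge0//.
rewrite -expR0 ler_expR mulNr oppr_le0 mulr_ge0 ?(ltW alpha2_gt0)//.
rewrite seriesEnat/= sumr_ge0// => i _.
exact: slack_ge0.
Qed.

(** A bounded nondecreasing series of slacks would force the convergence that is
    excluded, so the exponent in [solution_decay] tends to - oo. *)
Lemma signals'_asymptotically_stable sigma :
  signals' tau eta sigma -> asymptotically_stable A1 A2 sigma.
Proof.
move=> [Hs ncvg]; split; first exact: signals_stable.
case: Hs => dk [Hd s0 dP] x Hx.
have [C C0 decay] := solution_decay.
have Sy : series (slack tau eta dk) k @[k --> \oo] --> +oo.
  apply: nondecreasing_dvgn_lt.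
    apply/nondecreasing_seqP => k; rewrite !seriesEnat/= big_nat_recr//= lerDl.
    exact: slack_ge0.
  by move=> /(slack_cvg tau_gt0 eta_gt0 dP); exact: ncvg.
apply/cvgr0Pnorm_lt => e e0.
pose D := C * enorm (x 0).
have D0 : 0 <= D by rewrite mulr_ge0 ?enorm_ge0// ltW.
(* From S_k >= D / (e alpha2) on, exp(alpha2 S_k) >= 1 + D / e. *)
move/cvgryPge : Sy => /(_ (D / e / alpha2))[K _ SK].
exists (dk K.*2); split; first exact: num_real.
move=> t Kt; rewrite ger0_norm ?enorm_ge0//.
have t0 : 0 <= t by apply: le_trans (switching_times_ge0 K.*2 Hd) (ltW Kt).
have [k /andP[kt tk]] := signal_locate_cycle Hd t0.
have kt' : dk k.*2 <= t <= dk k.+1.*2 by rewrite kt ltW.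
apply: (le_lt_trans (decay _ _ Hd s0 dP x Hx k t kt')).
have Kk : (K <= k)%N.
  rewrite leqNgt; apply/negP => kK.
  have /(switching_times_homo Hd) : (k.+1.*2 <= K.*2)%N by rewrite leq_double.
  by move=> /(lt_le_trans tk)/(lt_trans Kt); rewrite ltxx.
rewrite mulrAC -/D mulNr expRN ltr_pdivrMr ?expR_gt0//.
have := SK k Kk; rewrite /= ler_pdivrMr// mulrC => DS.
have : D / e < expR (alpha2 * series (slack tau eta dk) k).
  by apply: lt_le_trans (expR_ge1Dx _); lra.
by rewrite ltr_pdivrMr// mulrC.
Qed.

End SwitchedSystem.

Theorem theorem8p2 (R : realType) (A1 A2 P1 P2 : 'M[R]_2)
  (n1 alpha2 beta2 a b c d eta : R)
  (n1_gt0 : 0 < n1) (alpha2_gt0 : 0 < alpha2) (beta2_neq0 : beta2 != 0)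
  (P1_unit : P1 \in unitmx) (P2_unit : P2 \in unitmx)
  (A1E : A1 = P1 *m mx22 (- n1) 1 0 (- n1) *m invmx P1)
  (A2E : A2 = P2 *m mx22 alpha2 beta2 (- beta2) alpha2 *m invmx P2)
  (ME : invmx P2 *m P1 = mx22 a b c d)
  (detM : \det (mx22 a b c d) = 1 \/ \det (mx22 a b c d) = -1)
  (eta_gt0 : 0 < eta) :
  exists tau21 : R,
    unique (fun t : R => 0 < t /\
      alpha2 * eta = n1 * t - asinh ((a ^+ 2 + c ^+ 2) / 2 * t)) tau21 /\
    (forall sigma, signals tau21 eta sigma -> stable A1 A2 sigma) /\
    (forall sigma, signals' tau21 eta sigma -> asymptotically_stable A1 A2 sigma).
Proof.
have k0 : 0 < (a ^+ 2 + c ^+ 2) / 2 by rewrite divr_gt0// (unimodular_col_gt0 detM).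
have [tau utau] := gap_solution n1_gt0 k0 (mulr_gt0 alpha2_gt0 eta_gt0).
have [[tau0 tauE] _] := utau.
exists tau; split=> //; split=> sigma.
  exact: (signals_stable n1_gt0 alpha2_gt0 P1_unit P2_unit A1E A2E ME detM).
exact: (signals'_asymptotically_stable n1_gt0 alpha2_gt0 P1_unit P2_unit A1E A2E ME detM).
Qed.
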